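(* Let $\mathcal{M}$ be a confounded ANM with Gaussian noise with $n$ treatments, and suppose that $d_{\max}$ is greater than or equal to the maximum degree in the observable graph of the ANM. If the parameter $\alpha$ is chosen as $\log n$ in algorithm LearnObservableGraph, then the maximum number of required interventions is $8\,d_{\max}\,(\log n)^3$ to return the observable graph with probability at least $1-\frac{1}{n^{\log(n)-2}}$. The algorithm also returns the required interventional data sets for inference with success probability at least $1-\frac{1}{n^{\log(n)-1}}$.
   Context: Setting. The SCM $\mathcal{M}$ has observed variables $\mathbf{V}=\{\mathbf{X},Y\}$ with treatments $\mathbf{X}=\{X_1,\dots,X_n\}$ and outcome $Y$, structural equations $X_i=f_i(Pa(X_i))+U_i$, $Y=f_Y(\mathbf{X})+U_Y$, and jointly Gaussian, possibly correlated noise $\mathbf{U}=(U_1,\dots,U_n,U_Y)\sim\mathcal{N}(\mu,\Sigma)$. The observable graph $G$ is the directed acyclic graph (DAG) on the observed variables with an edge from each variable in $Pa(V)$ to $V$; no treatment is a descendant of $Y$. An intervention on $\mathbf{S}\subseteq\mathbf{X}$ removes all edges (including those from latent variables) into $\mathbf{S}$; the resulting model is $\mathcal{M}_{do(\mathbf{S})}$ and the resulting graph is $G_{\overline{\mathbf{S}}}$. $\log$ is base 2. For any $\mathbf{S}\subseteq \mathbf{X}$ one may intervene and sample from $\mathcal{M}_{do(\mathbf{S})}$, and conditional independence tests on it correctly report whether two variables are d-connected in $G_{\overline{\mathbf{S}}}$ (with latent confounding included). Transitive closure and reduction. The transitive closure $G^{tc}$ of a DAG $G$ has an edge $V_i\to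 V_j$ exactly when $G$ has a directed path from $V_i$ to $V_j$. The transitive reduction $Tr(G)$ is the (unique) DAG with the minimum number of edges having the same transitive closure as $G$. Strongly separating set system. A collection $\{\mathbf{S}_1,\dots,\mathbf{S}_m\}$ of subsets of $\mathbf{X}$ such that for any pair $X_i,X_j$ there are members $\mathbf{S}_i,\mathbf{S}_j$ with $X_i\in\mathbf{S}_i\setminus\mathbf{S}_j$ and $X_j\in\mathbf{S}_j\setminus\mathbf{S}_i$; one with $m\le 2\lceil\log n\rceil$ exists. Subroutine LearnTransitiveClosure($\mathcal{M}$). Start with $\mathbf{E}=\emptyset$; fix a strongly separating set system $\{\mathbf{S}_1,\dots,\mathbf{S}_m\}$ with $m\le 2\lceil\log n\rceil$; for each $k$ and each pair $X_i\in\mathbf{S}_k$, $X_j\in\mathbf{V}\setminus\mathbf{S}_k$, use samples from $\mathcal{M}_{do(\mathbf{S}_k)}$ and, if $X_i$ and $X_j$ are dependent in $G_{\overline{\mathbf{S}_k}}$, add the directed edge $X_i\to X_j$ to $\mathbf{E}$. Output the graph $(\mathbf{V},\mathbf{E})$ as the transitive closure. Algorithm LearnObservableGraph($\mathcal{M}$) with parameters $\alpha$, $d_{\max}$. Start with $\mathbf{E}=\emptyset$ and a data collection consisting of observational samples. Repeat $4\alpha\, d_{\max}\log n$ times: form a random set $\mathbf{S}$ by including each $X_i\in\mathbf{X}$ independently with probability $1-\frac{1}{d_{\max}}$; run LearnTransitiveClosure($\mathcal{M}_{do(\mathbf{S})}$) to obtain $G_{\overline{\mathbf{S}}}^{tc}$;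 compute $Tr(G_{\overline{\mathbf{S}}}^{tc})$ and add any of its edges missing from $\mathbf{E}$ to $\mathbf{E}$; sample data from $\mathcal{M}_{do(\mathbf{S})}$ and add it to the data collection. Return the graph $(\mathbf{V},\mathbf{E})$ and the data collection. The algorithm ''returns the required interventional data sets for inference'' if for every treatment $X_i\in\mathbf{X}$ at least one of the sampled sets $\mathbf{S}$ satisfies $Pa(X_i)\subseteq\mathbf{S}$ and $X_i\notin\mathbf{S}$.
   Formalization: The data-set guarantee is stated for d_max > 1 (at d_max = 1 all sampled sets are empty and it fails); the bound 8 d_max (log n)^3 counts distinct intervened sets and holds for a suitable strongly separating system with m ≤ 2⌈log n⌉, as it fails for some such systems. *)

(* Defs.v *)
From HB Require Import structures.
From mathcomp Require Import all_boot all_order all_algebra.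
From mathcomp Require Import all_classical all_reals all_analysis.

Set Implicit Arguments.
Unset Strict Implicit.
Unset Printing Implicit Defensive.

Import Order.TTheory GRing.Theory Num.Theory.
Local Open Scope ring_scope.

(* [Some i] is the treatment X_i, [None] is the outcome Y. *)
Definition vertex (n : nat) := option 'I_n.

Definition treatments n (S : {set 'I_n}) : {set vertex n} := [set Some i | i in S].

(** ** Directed graphs, given by their set of edges *)

Definition digraph (V : finType) := {set V * V}.

Definition edge (V : finType) (E : digraph V) : rel V :=
  fun u v => (u, v) \in E.

(* No edge is closed into a directed cycle by a directed path back. *)
Definition acyclic (V : finType) (E : digraph V) : bool :=
  [forall u, forall v, edge E u v ==> ~~ connect (edge E) v u].

(* [connect] is reflexive, hence the explicit first edge: paths have length at
   least one. *)
Definition transitive_closure (V : finType) (E : digraph V) : digraph V :=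
  [set e | [exists w, edge E e.1 w && connect (edge E) w e.2]].

(* For acyclic [E] the minimizer is unique (and [E] itself is a candidate). *)
Definition transitive_reduction (V : finType) (E : digraph V) : digraph V :=
  [arg min_(F < E | acyclic F && (transitive_closure F == transitive_closure E))
     #|F|]%N.

(* Degree in the sense of the number of neighbours, parents and children. *)
Definition degree (V : finType) (E : digraph V) (v : V) : nat :=
  #|[set w | edge E v w || edge E w v]|.

Definition max_degree (V : finType) (E : digraph V) : nat :=
  (\max_(v : V) degree E v)%N.

(** ** Graphs with latent confounding and d-connection *)

(* [confounded u v] is the bidirected edge u <-> v standing for a latent common
   cause of u and v; it has an arrowhead at both ends. *)
Record mixed_graph (V : finType) := MixedGraph {
  directed : digraph V;
  confounded : rel V
}.

Inductive orientation := Forward | Backward | Bidirected.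

(* A path from [u] is a list of steps (orientation of the edge, next vertex). *)
Definition step (V : finType) := (orientation * V)%type.

Definition is_step (V : finType) (G : mixed_graph V) (u : V) (s : step V) : bool :=
  match s.1 with
  | Forward => edge (directed G) u s.2
  | Backward => edge (directed G) s.2 u
  | Bidirected => confounded G u s.2
  end.

Fixpoint is_walk (V : finType) (G : mixed_graph V) (u : V) (p : seq (step V)) : bool :=
  if p is s :: p' then is_step G u s && is_walk G s.2 p' else true.

Definition head_at_target (o : orientation) : bool :=
  if o is Backward then false else true.

Definition head_at_source (o : orientation) : bool :=
  if o is Forward then false else true.

(* No inner vertex blocks the path given [Z]: a collider has a descendant
   (possibly itself) in [Z], a non-collider lies outside [Z]. *)
Fixpoint unblocked (V : finType) (G : mixed_graph V) (Z : {set V})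
    (p : seq (step V)) : bool :=
  match p with
  | s :: ((t :: _) as p') =>
      (if head_at_target s.1 && head_at_source t.1
       then [exists z in Z, connect (edge (directed G)) s.2 z]
       else s.2 \notin Z) && unblocked G Z p'
  | _ => true
  end.

Definition d_connected (V : finType) (G : mixed_graph V) (Z : {set V}) (u v : V) : Prop :=
  exists p : seq (step V),
    [/\ is_walk G u p, last u (map snd p) = v,
        uniq (u :: map snd p) & unblocked G Z p].

(* All edges into [S] are removed, including those from latent variables. *)
Definition cut_incoming (V : finType) (G : mixed_graph V) (S : {set V}) : mixed_graph V :=
  MixedGraph [set e in directed G | e.2 \notin S]
             [rel u v | [&& confounded G u v, u \notin S & v \notin S]].

(** ** Confounded additive noise models with Gaussian noise *)

(* Univariate normal law of mean [m] and variance [v]; the degenerate case is a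
   point mass ([normal_prob m 0] is a different convention). *)
Definition gaussian_law (R : realType) (m v : R) (A : set R) : \bar R :=
  if v == 0 then \d_m A else normal_prob m (Num.sqrt v) A.

(* [U] has law N(mu, Sigma): every linear combination of its coordinates is
   normal with the mean and variance prescribed by [mu] and [Sigma]. *)
Definition gaussian_vector (R : realType) d (Omega : measurableType d)
    (P : probability Omega R) (I : finType) (U : I -> {RV P >-> R})
    (mu : I -> R) (Sigma : I -> I -> R) : Prop :=
  [/\ (forall i j, Sigma i j = Sigma j i),
      (forall c : I -> R, 0 <= \sum_i \sum_j c i * Sigma i j * c j) &
      (forall (c : I -> R) (A : set R), measurable A ->
         P (preimage (fun w : Omega => \sum_i c i * U i w) A) =
         gaussian_law (\sum_i c i * mu i)
                      (\sum_i \sum_j c i * Sigma i j * c j) A)].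

Record gaussian_anm (R : realType) d (Omega : measurableType d)
    (P : probability Omega R) (n : nat) := GaussianANM {
  parents : vertex n -> {set vertex n};
  mechanism : vertex n -> (vertex n -> R) -> R;
  noise : vertex n -> {RV P >-> R};
  noise_mean : vertex n -> R;
  noise_cov : vertex n -> vertex n -> R;
  observed : vertex n -> Omega -> R;
  mechanism_parents : forall v (x y : vertex n -> R),
    {in parents v, x =1 y} -> mechanism v x = mechanism v y;
  structural_equation : forall v w,
    observed v w = mechanism v (fun u => observed u w) + noise v w;
  noise_gaussian : gaussian_vector noise noise_mean noise_cov;
  parents_acyclic : acyclic [set e | e.1 \in parents e.2];
  outcome_no_treatment_descendant : forall i : 'I_n,
    ~~ connect (edge [set e | e.1 \in parents e.2]) None (Some i)
}.

Section GraphsOfModel.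
Context (R : realType) (d : measure_display) (Omega : measurableType d)
  (P : probability Omega R) (n : nat).
Implicit Type M : gaussian_anm P n.

Definition observable_graph M : digraph (vertex n) :=
  [set e | e.1 \in parents M e.2].

(* Jointly Gaussian noises are dependent exactly when they are correlated. *)
Definition latent_graph M : mixed_graph (vertex n) :=
  MixedGraph (observable_graph M)
             [rel u v | (u != v) && (noise_cov M u v != 0)].

Definition interventional_graph M (S : {set 'I_n}) : mixed_graph (vertex n) :=
  cut_incoming (latent_graph M) (treatments S).

(* [dep S u v] is the answer "u and v are dependent" of the independence test
   run on samples from M_do(S). *)
Definition correct_tests M (dep : {set 'I_n} -> rel (vertex n)) : Prop :=
  forall (S : {set 'I_n}) (u v : vertex n), u != v ->
    (dep S u v <-> d_connected (interventional_graph M S) finset.set0 u v).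

(* The draws [Ss] contain, for every treatment, a data set on which all its
   parents, but not the treatment itself, are intervened on. *)
Definition has_required_data M (Ss : seq {set 'I_n}) : bool :=
  [forall i, has (fun S => (parents M (Some i) \subset treatments S) &&
                           (i \notin S)) Ss].

End GraphsOfModel.

(** ** The learning algorithm *)

Section Algorithm.
Variable n : nat.
Implicit Types (S : {set 'I_n}) (sys : {set {set 'I_n}}) (Ss : seq {set 'I_n})
  (dep : {set 'I_n} -> rel (vertex n)).

Definition strongly_separating sys : Prop :=
  forall i j : 'I_n, i != j ->
    exists A B, [/\ A \in sys, B \in sys, i \in A :\: B & j \in B :\: A].

(* [up_log 2 n] is the integer ceiling of the binary logarithm of n. *)
Definition admissible_system sys : Prop :=
  strongly_separating sys /\ (#|sys| <= 2 * up_log 2 n)%N.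

(* The subroutine run on M_do(S): its interventions do(A) take place in
   M_do(S), i.e. they are the interventions do(S :|: A) on the original model. *)
Definition learn_transitive_closure dep sys S : digraph (vertex n) :=
  [set e | [exists A in sys,
     [&& e.1 \in treatments A, e.2 \notin treatments A & dep (S :|: A) e.1 e.2]]].

(* [Ss] lists the random sets drawn in the successive iterations. The returned
   data collection consists of the observational samples and of one data set
   from M_do(S) for each S in [Ss]. *)
Definition learn_observable_graph dep sys Ss : digraph (vertex n) :=
  \bigcup_(S <- Ss) transitive_reduction (learn_transitive_closure dep sys S).

(* All targets that are intervened on during the run: for each drawn S, those of
   the subroutine and S itself. *)
Definition interventions sys Ss : {set {set 'I_n}} :=
  \bigcup_(S <- Ss) (S |: [set S :|: A | A in sys]).

End Algorithm.

Definition log2 (R : realType) (x : R) : R := ln x / ln 2.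

(* Number of iterations, rounded down to an integer. *)
Definition iterations (R : realType) (alpha : R) (dmax n : nat) : nat :=
  Num.truncn (4 * alpha * dmax%:R * log2 (n%:R : R)).

(* Probability of the event [E] when T subsets of 'I_n are drawn independently,
   each containing each i independently with probability 1 - 1 / dmax. *)
Definition draws_prob (R : realType) (dmax n T : nat)
    (E : pred (T.-tuple {set 'I_n})) : R :=
  \sum_(Ss : T.-tuple {set 'I_n} | E Ss)
    \prod_(S <- Ss) \prod_(i < n)
      (if i \in S then 1 - dmax%:R^-1 else dmax%:R^-1).

(* Main.v *)
(* Since nothing is conditioned on, the tests of the subroutine on M_do(S) detect
   exactly the directed paths of the cut graph G_S, so the computed reduction is
   the set of covering edges of G_S: a subset of G, which contains u -> v as soon
   as S avoids v and contains the other parents of v.  A random S does so, or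
   contains all parents of a treatment v and avoids v, with probability at least
   (1 - 1/d)^d / d >= 1/(4d) for d = dmax >= 2.  Hence all T iterations miss a given
   edge or treatment with probability at most
   (1 - 1/(4d))^T <= exp (1/4 - L^2) <= exp (- L^2 ln 2) = n^(-L) if n >= 2, and a
   union bound over at most n^2 edges, or n treatments, finishes.

   The bound on the interventions leaves 2L of them per iteration, the drawn set
   included, which a system of 2 * ceil(L) sets may exceed.  Labelling the
   treatments by the k-subsets of an m-set gives a system of m sets whenever
   n <= C(m, k), and such an m with m + 1 <= 2L exists for n >= 8 except n = 11.  For
   1 < n <= 7 all 2^n targets together are few enough; for n = 11 the 4-subsets of a 6-set
   give members so large that few targets contain one of them. *)
Require Import Defs.
From HB Require Import structures.
From mathcomp Require Import all_boot all_order all_algebra.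
From mathcomp Require Import all_classical all_reals all_analysis.
From mathcomp Require Import ring lra zify.
Set Implicit Arguments.
Unset Strict Implicit.
Unset Printing Implicit Defensive.
Import Order.TTheory GRing.Theory Num.Theory.
Local Open Scope ring_scope.

(** * Transitive reduction of an acyclic graph *)

Section TransitiveReduction.
Variable V : finType.
Implicit Types (E F : digraph V) (u v w : V).

Lemma transitive_closureP E u v :
  reflect (exists2 w, edge E u w & connect (edge E) w v)
          ((u, v) \in transitive_closure E).
Proof.
rewrite inE; apply: (iffP existsP) => [[w /andP[uw wv]]|[w uw wv]]; exists w => //.
exact/andP.
Qed.

Lemma sub_transitive_closure E : E \subset transitive_closure E.
Proof.
by apply/fintype.subsetP => -[u v] uv; apply/transitive_closureP; exists v.
Qed.

Lemma transitive_closure_connect E u v :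
  (u, v) \in transitive_closure E -> connect (edge E) u v.
Proof.
by case/transitive_closureP => w uw; apply: connect_trans; apply: connect1.
Qed.

Lemma transitive_closure_connectl E u v w :
  connect (edge E) u v -> (v, w) \in transitive_closure E ->
  (u, w) \in transitive_closure E.
Proof.
case/connectP => p pth ->; elim: p u pth => [|x p IH] u //= /andP[ux px] h.
by apply/transitive_closureP; exists x; [|exact/transitive_closure_connect/IH].
Qed.

Lemma transitive_closure_trans E u v w :
  (u, v) \in transitive_closure E -> (v, w) \in transitive_closure E ->
  (u, w) \in transitive_closure E.
Proof. by move/transitive_closure_connect/transitive_closure_connectl; apply. Qed.

Lemma transitive_closure_sub E F :
  F \subset transitive_closure E -> transitive_closure F \subset transitive_closure E.
Proof.
move/fintype.subsetP => FE; apply/fintype.subsetP => -[u v] /transitive_closureP [w /FE uw].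
case/connectP => p pth ->; elim: p w uw pth => [|x p IH] w uw //= /andP[/FE wx].
by apply: IH; apply: transitive_closure_trans uw wx.
Qed.

Lemma transitive_closure_between E F :
  E \subset F -> F \subset transitive_closure E ->
  transitive_closure F = transitive_closure E.
Proof.
move=> EF FE; apply/eqP; rewrite finset.eqEsubset !transitive_closure_sub //.
exact: fintype.subset_trans EF (sub_transitive_closure F).
Qed.

Lemma acyclicP E :
  reflect (forall u, (u, u) \notin transitive_closure E) (acyclic E).
Proof.
apply: (iffP forallP) => [ac u|ac u].
  apply/negP => /transitive_closureP [w uw wu].
  by move/forallP/(_ w)/implyP/(_ uw)/negP: (ac u).
apply/forallP => v; apply/implyP => uv; apply/negP => vu.
by move/negP: (ac u); apply; apply/transitive_closureP; exists v.
Qed.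

Lemma acyclic_irrefl E u : acyclic E -> ~~ edge E u u.
Proof.
by move/acyclicP/(_ u); apply: contra; apply/fintype.subsetP/sub_transitive_closure.
Qed.

(** For acyclic [E], the covering relation of the strict order given by the closure; it depends on
    the closure alone. *)
Definition covering_edges E : digraph V :=
  [set e in transitive_closure E |
    ~~ [exists w, ((e.1, w) \in transitive_closure E)
               && ((w, e.2) \in transitive_closure E)]].

(** A path of length at least two has an inner vertex strictly between its ends, so a covering pair
    can only be joined by a single edge. *)
Lemma covering_edges_sub E F :
  transitive_closure F = transitive_closure E -> covering_edges E \subset F.
Proof.
move=> tcFE; apply/fintype.subsetP => -[u v]; rewrite inE -tcFE => /andP[] /=.
case/transitive_closureP => w uw /connectP [[|x p] /=]; first by move=> _ ->.
case/andP => wx xp -> /existsP []; exists w.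
rewrite (fintype.subsetP (sub_transitive_closure F)) //=; apply/transitive_closureP; exists x => //.
by apply/connectP; exists p.
Qed.

(** Induction on the number of vertices between [u] and [v]: a pair that is not covering splits at
    some [w], and acyclicity removes [w] from both smaller intervals. *)
Lemma transitive_closure_covering_edges E :
  acyclic E -> transitive_closure (covering_edges E) = transitive_closure E.
Proof.
move/acyclicP => ac; apply/eqP; rewrite finset.eqEsubset transitive_closure_sub /=; last first.
  by apply/fintype.subsetP => e; rewrite inE => /andP[].
apply/fintype.subsetP => -[u v].
pose between u v := [set w | ((u, w) \in transitive_closure E)
                          && ((w, v) \in transitive_closure E)].
have betweenE x y w : (w \in between x y) =
    ((x, w) \in transitive_closure E) && ((w, y) \in transitive_closure E).
  by rewrite inE.
have [m] := ubnP #|between u v|; elim: m u v => // m IH u v; rewrite ltnS => lem uv.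
have [/existsP [w /= /andP[uw wv]]|cov] :=
  boolP [exists w, ((u, w) \in transitive_closure E)
               && ((w, v) \in transitive_closure E)]; last first.
  by apply: (fintype.subsetP (sub_transitive_closure _)); rewrite inE uv.
apply: (@transitive_closure_trans _ _ w); apply: IH => //; apply: leq_trans lem.
  apply: proper_card; apply/properP; split; last first.
    by exists w; rewrite betweenE ?uw // negb_and ac orbT.
  apply/fintype.subsetP => x; rewrite !betweenE => /andP[-> /=].
  by move/transitive_closure_trans; apply.
apply: proper_card; apply/properP; split; last first.
  by exists w; rewrite betweenE ?uw // negb_and ac.
apply/fintype.subsetP => x; rewrite !betweenE => /andP[wx ->].
by rewrite (transitive_closure_trans uw).
Qed.

(** The covering edges lie in every candidate and form one themselves, so a candidate of minimal
    cardinality equals them. *)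
Lemma transitive_reductionE E :
  acyclic E -> transitive_reduction E = covering_edges E.
Proof.
move=> ac; rewrite /transitive_reduction.
case: arg_minnP => [|F /andP[_ /eqP tcF] minF]; first by rewrite ac eqxx.
apply/eqP; rewrite eq_sym eqEcard covering_edges_sub // minF //.
rewrite transitive_closure_covering_edges // eqxx andbT.
by apply/acyclicP => u; rewrite transitive_closure_covering_edges //; exact/acyclicP.
Qed.

End TransitiveReduction.

(** * Learning from one drawn set *)

Lemma transitive_closureP_last (V : finType) (E : digraph V) u v :
  reflect (exists2 w, connect (edge E) u w & edge E w v)
          ((u, v) \in transitive_closure E).
Proof.
apply: (iffP idP) => [/transitive_closureP [x ux /connectP [p]]|[w uw wv]]; last first.
  apply: transitive_closure_connectl uw _.
  by apply: (fintype.subsetP (sub_transitive_closure E)).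
elim/last_ind: p v => [|p y _] v /=; first by move=> _ ->; exists u.
rewrite rcons_path last_rcons => /andP[xp xy] ->.
exists (last x p) => //; apply: connect_trans (connect1 ux) _.
by apply/connectP; exists p.
Qed.

Lemma transitive_closure_neq (V : finType) (E : digraph V) u v :
  connect (edge E) u v -> u != v -> (u, v) \in transitive_closure E.
Proof.
case/connectP => -[|x p] /=; first by move=> _ ->; rewrite eqxx.
case/andP => ux xp -> _; apply/transitive_closureP; exists x => //.
by apply/connectP; exists p.
Qed.

(** * Directed paths and d-connection in cut graphs *)

Section CutGraph.
Variables (V : finType) (G : mixed_graph V).
Implicit Types (S T : {set V}) (u v w : V).

Lemma edge_cut S u v :
  edge (directed (cut_incoming G S)) u v = edge (directed G) u v && (v \notin S).
Proof. by rewrite /edge /= inE. Qed.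

Lemma sub_cut S : directed (cut_incoming G S) \subset directed G.
Proof. by apply/fintype.subsetP => e; rewrite inE => /andP[]. Qed.

Lemma connect_cutS S T u v : S \subset T ->
  connect (edge (directed (cut_incoming G T))) u v ->
  connect (edge (directed (cut_incoming G S))) u v.
Proof.
move=> ST; apply: connect_sub => x y; rewrite edge_cut => /andP[xy yT].
by apply: connect1; rewrite edge_cut xy (contra (fintype.subsetP ST y)).
Qed.

(* Conditioning on the empty set, every collider blocks: once a path leaves its
   first vertex through an arrow tail, it is a directed path. *)
Lemma unblocked_connect u p :
  is_walk G u p -> unblocked G finset.set0 p ->
  (if p is s :: _ then ~~ head_at_source s.1 else true) ->
  connect (edge (directed G)) u (last u (map snd p)).
Proof.
elim: p u => [|[a x] p IH] u //= /andP[st wp] ub tail.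
case: a tail st ub => // _ ux ub.
apply: connect_trans (connect1 ux) (IH x wp _ _); case: p wp ub {IH} => //= t p.
  by move=> _ /andP[].
move=> _ /andP[+ _]; case: ifP => [_ /existsP [z]|]; last by case: t => -[].
by rewrite inE.
Qed.

Lemma connect_d_connected u v :
  connect (edge (directed G)) u v -> d_connected G finset.set0 u v.
Proof.
case/connectP => p0 pth -> {v}; case/shortenP: pth => p pth up _.
have sndp : map snd [seq (Forward, x) | x <- p] = p.
  by rewrite -map_comp map_id.
exists [seq (Forward, x) | x <- p]; split; rewrite ?sndp //.
  by elim: p u pth {up sndp} => [|x p IH] u //= /andP[ux /IH ->]; rewrite andbT.
by elim: p {pth up sndp} => [|x [|y p] IH] //=; rewrite finset.in_set0.
Qed.

End CutGraph.

(** No arrowhead, directed or bidirected, points at a vertex of [S], so a path leaves [u] through a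
    tail. *)
Lemma d_connected_cut (V : finType) (G : mixed_graph V) (S : {set V}) u v :
  u \in S -> d_connected (cut_incoming G S) finset.set0 u v ->
  connect (edge (directed (cut_incoming G S))) u v.
Proof.
move=> uS [p [wp <- _ ub]]; apply: unblocked_connect => //.
case: p wp ub => // -[[] x] p //= /andP[+ _] _; rewrite /is_step /=.
  by rewrite edge_cut uS andbF.
by rewrite uS andbF.
Qed.

Lemma mem_treatments n (S : {set 'I_n}) (i : 'I_n) : (Some i \in treatments S) = (i \in S).
Proof. by rewrite mem_imset // => ? ? []. Qed.

Lemma None_treatments n (S : {set 'I_n}) : None \notin treatments S.
Proof. by apply/negP => /imsetP[]. Qed.

Lemma treatmentsS n (S T : {set 'I_n}) : S \subset T -> treatments S \subset treatments T.
Proof. exact: imsetS. Qed.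

Section Learning.
Variables (n : nat) (G : mixed_graph (vertex n)).
Variables (dep : {set 'I_n} -> rel (vertex n)) (sys : {set {set 'I_n}}).
Hypothesis acyclicG : acyclic (directed G).
Hypothesis outcome_sink : forall v, ~~ edge (directed G) None v.
Hypothesis dep_correct : forall (S : {set 'I_n}) (u v : vertex n), u != v ->
  (dep S u v <-> d_connected (cut_incoming G (treatments S)) finset.set0 u v).
Hypothesis sysP : strongly_separating sys.

Local Notation cut S := (directed (cut_incoming G (treatments S))).

Lemma acyclic_cut S : acyclic (cut S).
Proof.
move/acyclicP: acyclicG => ac; apply/acyclicP => u; apply: contra (ac u).
apply/fintype.subsetP/transitive_closure_sub.
exact: fintype.subset_trans (sub_cut _ _) (sub_transitive_closure _).
Qed.

Lemma learn_transitive_closure_sub S :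
  learn_transitive_closure dep sys S \subset transitive_closure (cut S).
Proof.
apply/fintype.subsetP => -[u v].
rewrite inE => /existsP [A /andP[_ /and3P[/= uA vA duv]]].
have neq : u != v by apply: contraNneq vA => <-.
apply: transitive_closure_neq => //.
apply: (@connect_cutS _ _ _ (treatments (S :|: A))); first exact/treatmentsS/finset.subsetUl.
apply: d_connected_cut; last exact/dep_correct.
exact: (fintype.subsetP (treatmentsS (finset.subsetUr S A))).
Qed.

(* With a single treatment the empty system is strongly separating, and an edge
   into the outcome goes unnoticed. *)
Lemma sub_learn_transitive_closure S : (1 < n)%N ->
  cut S \subset learn_transitive_closure dep sys S.
Proof.
move=> n_gt1; apply/fintype.subsetP => -[[i|] v] euv; last first.
  by move: euv (outcome_sink v); rewrite inE => /andP[+ _]; rewrite /edge => ->.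
(* If [v] is a treatment, [A] separates [i] from it; if [v] is the outcome, any member containing
   [i] will do, and a second treatment provides one. *)
have [A [Asys iA vA]] : exists A, [/\ A \in sys, i \in A & v \notin treatments A].
  case: v euv => [j|] euv.
    have ij : i != j.
      by apply: contraTneq euv => <-; exact/acyclic_irrefl/acyclic_cut.
    have [A [B [AS _ /setDP[iA jB] /setDP[jB' jA]]]] := sysP ij.
    by exists A; split; rewrite ?mem_treatments.
  have [j ji] : exists j : 'I_n, i != j.
    have : (0 < #|[set~ i]|)%N by rewrite finset.cardsC1 card_ord -ltnS prednK // ltnW.
    by case/card_gt0P => j; rewrite !inE eq_sym; exists j.
  have [A [B [AS _ /setDP[iA _] _]]] := sysP ji.
  by exists A; split; rewrite ?None_treatments.
rewrite inE; apply/existsP; exists A; rewrite Asys mem_treatments iA vA /=.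
apply/dep_correct; first by apply: contraNneq vA => <-; rewrite mem_treatments.
apply/connect_d_connected/connect1; rewrite edge_cut.
move: euv; rewrite inE /edge => /andP[-> /=] vS.
by rewrite /treatments finset.imsetU finset.in_setU negb_or vS.
Qed.

(** The learned graph may miss pairs whose paths run through the extra targets [A], but it lies
    between the cut graph and its closure, which fixes its closure and hence its covering edges. *)
Lemma reduction_learn S : (1 < n)%N ->
  transitive_reduction (learn_transitive_closure dep sys S) = covering_edges (cut S).
Proof.
move=> n_gt1.
have tcE : transitive_closure (learn_transitive_closure dep sys S)
         = transitive_closure (cut S).
  apply: transitive_closure_between; last exact: learn_transitive_closure_sub.
  exact: sub_learn_transitive_closure.
rewrite transitive_reductionE /covering_edges ?tcE //.
by apply/acyclicP => u; rewrite tcE; move: u; apply/acyclicP/acyclic_cut.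
Qed.

(** On a detour from [u] to [v], the last vertex [x] before [v] is a parent of [v]. If it differs
    from [u], it lies in [S] and cannot be entered; if it is [u], there is a cycle. *)
Lemma covering_edges_cut S u v :
  edge (directed G) u v -> v \notin treatments S ->
  (forall w, edge (directed G) w v -> w != u -> w \in treatments S) ->
  (u, v) \in covering_edges (cut S).
Proof.
move=> uv vS pav; rewrite inE; apply/andP; split.
  by apply: (fintype.subsetP (sub_transitive_closure _)); rewrite inE vS andbT.
apply/negP => /existsP [w /= /andP[uw]] /transitive_closureP_last [x wx].
rewrite edge_cut => /andP[xv _].
have ux : (u, x) \in transitive_closure (cut S).
  case/transitive_closureP: uw => y uy yw; apply/transitive_closureP; exists y => //.
  exact: connect_trans wx.
have /transitive_closureP_last [y _] := ux; rewrite edge_cut => /andP[_ xS].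
have [xu|xu] := eqVneq x u; last by rewrite pav in xS.
by move: ux; rewrite xu; apply/negP; move: u {xu uv pav uw}; apply/acyclicP/acyclic_cut.
Qed.

Lemma learn_observable_graph_sub Ss : (1 < n)%N ->
  learn_observable_graph dep sys Ss \subset directed G.
Proof.
move=> n_gt1; rewrite /learn_observable_graph.
elim/big_ind: _ => [|E F EG FG|S _]; first exact: finset.sub0set.
  by rewrite finset.subUset EG.
rewrite reduction_learn //; apply: fintype.subset_trans (sub_cut _ (treatments S)).
exact: covering_edges_sub.
Qed.

Lemma learn_observable_graph_complete (Ss : seq {set 'I_n}) : (1 < n)%N ->
  (forall u v, edge (directed G) u v ->
     has (fun S => (v \notin treatments S) &&
       [forall w, (edge (directed G) w v && (w != u)) ==> (w \in treatments S)]) Ss) ->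
  learn_observable_graph dep sys Ss = directed G.
Proof.
move=> n_gt1 found; apply/eqP; rewrite finset.eqEsubset learn_observable_graph_sub //=.
apply/fintype.subsetP => -[u v] uv.
have /hasP [S SSs /andP[vS /forallP pav]] := found u v uv.
rewrite /learn_observable_graph (big_rem S) //= finset.in_setU; apply/orP; left.
rewrite reduction_learn //; apply: covering_edges_cut => // w wv wu.
by move: (pav w); rewrite wv wu.
Qed.

End Learning.

(** * Independent random draws *)

(** Independence of the draws: the power of the sum expands into a sum over functions, which are
    identified with tuples. *)
Lemma sum_tuple_all (R : comPzSemiRingType) (I : finType) (Q : pred I) (f : I -> R) T :
  \sum_(t : T.-tuple I | all Q t) \prod_(x <- t) f x = (\sum_(x | Q x) f x) ^+ T.
Proof.
rewrite -[in RHS](card_ord T) -prodr_const bigA_distr_big.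
rewrite (reindex (@finfun_of_tuple I T)); last first.
  exists (@tuple_of_finfun I T) => ? _; first exact: finfun_of_tupleK.
  exact: tuple_of_finfunK.
apply: eq_big => [t|t _].
  apply/all_tnthP/ffun_onP => h i; first by rewrite ffunE; exact: h.
  by have := h i; rewrite ffunE.
by rewrite big_tuple; apply: eq_bigr => i _; rewrite ffunE.
Qed.

Section Draws.
Variables (R : realType) (dmax n : nat).
Hypothesis dmax_gt0 : (0 < dmax)%N.

Definition draw_weight (S : {set 'I_n}) : R :=
  \prod_(i < n) (if i \in S then 1 - dmax%:R^-1 else dmax%:R^-1).

Let in_ge0 : 0 <= 1 - dmax%:R^-1 :> R.
Proof. by rewrite subr_ge0 invf_le1 ?ler1n ?ltr0n. Qed.

Let out_ge0 : 0 <= dmax%:R^-1 :> R.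
Proof. by rewrite invr_ge0 ler0n. Qed.

Lemma draw_weight_ge0 S : 0 <= draw_weight S.
Proof. by apply: prodr_ge0 => i _; case: ifP. Qed.

(** Zeroing the inclusion factor on [C] and the exclusion factor on [B] kills the terms outside the
    cylinder; the sum over all sets then factorizes over the coordinates. *)
Lemma sum_draw_weight_cylinder (B C : {set 'I_n}) : [disjoint B & C] ->
  \sum_(S : {set 'I_n} | (B \subset S) && [disjoint C & S]) draw_weight S
  = (1 - dmax%:R^-1) ^+ #|B| * dmax%:R^-1 ^+ #|C|.
Proof.
move=> BC.
pose F i : R := if i \in C then 0 else 1 - dmax%:R^-1.
pose G i : R := if i \in B then 0 else dmax%:R^-1.
transitivity (\sum_(S : {set 'I_n}) \prod_i (if i \in S then F i else G i)).
  rewrite [RHS](bigID (fun S : {set 'I_n} => (B \subset S) && [disjoint C & S])) /=.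
  rewrite [X in _ = _ + X]big1 ?addr0 => [|S].
    apply: eq_bigr => S /andP[/fintype.subsetP BS CS]; apply: eq_bigr => i _.
    rewrite /F /G; have [iS|iS] := boolP (i \in S).
      by rewrite (disjointFl CS iS).
    by rewrite (contraNF (BS i) iS).
  rewrite negb_and => /orP[/subsetPn [i iB iS]|/pred0Pn [i /= /andP[iC iS]]].
    by rewrite (bigD1 i) //= (negbTE iS) /G iB mul0r.
  by rewrite (bigD1 i) //= iS /F iC mul0r.
rewrite -bigA_distr -!prodr_const [X in _ = X * _]big_mkcond [X in _ = _ * X]big_mkcond.
rewrite -big_split /=.
apply: eq_bigr => i _; rewrite /F /G; have [iB|iB] := boolP (i \in B).
  by rewrite (disjointFr BC iB) addr0 mulr1.
by case: ifP => _; rewrite ?add0r ?mul1r ?subrK.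
Qed.

Lemma sum_draw_weight : \sum_(S : {set 'I_n}) draw_weight S = 1.
Proof.
have := @sum_draw_weight_cylinder finset.set0 finset.set0.
rewrite !cards0 !expr0 mulr1 => <-; last by rewrite finset.disjoints_subset finset.sub0set.
by apply: eq_bigl => S; rewrite finset.sub0set finset.disjoints_subset finset.sub0set.
Qed.

Lemma draws_prob_ge0 T (E : pred (T.-tuple {set 'I_n})) : 0 <= draws_prob R dmax E.
Proof. by apply: sumr_ge0 => t _; apply: prodr_ge0 => S _; exact: draw_weight_ge0. Qed.

(** Union bound: if [E] fails, all [T] draws miss some [k] in [C], which by independence has
    probability at most [(1 - p) ^+ T]. *)
Lemma draws_prob_union T (K : finType) (C : {pred K}) (Q : K -> pred {set 'I_n})
    (E : pred (T.-tuple {set 'I_n})) (p : R) :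
  (forall k, k \in C -> p <= \sum_(S | Q k S) draw_weight S) ->
  (forall Ss : T.-tuple {set 'I_n}, (forall k, k \in C -> has (Q k) Ss) -> E Ss) ->
  1 - #|C|%:R * (1 - p) ^+ T <= draws_prob R dmax E.
Proof.
move=> pQ QE.
pose w (t : T.-tuple {set 'I_n}) := \prod_(S <- t) draw_weight S.
have w_ge0 t : 0 <= w t by apply: prodr_ge0 => S _; exact: draw_weight_ge0.
have tot : \sum_(t : T.-tuple {set 'I_n}) w t = 1.
  transitivity (\sum_(t : T.-tuple {set 'I_n} | all predT t) w t).
    by apply: eq_bigl => t; rewrite all_predT.
  by rewrite sum_tuple_all sum_draw_weight expr1n.
rewrite lerBlDr -{1}tot (bigID E) /=; apply: lerD => //.
apply: (@le_trans _ _ (\sum_(k in C) \sum_(t : T.-tuple {set 'I_n} | all (predC (Q k)) t) w t)).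
  rewrite (exchange_big_dep predT) //= big_mkcond; apply: ler_sum => t _.
  have inner_ge0 : 0 <= \sum_(k in C | all (predC (Q k)) t) w t by apply: sumr_ge0.
  case: ifP => // /negP nE.
  have [k /andP[kC kQ]|none] := pickP [pred k in C | ~~ has (Q k) t].
    rewrite (bigD1 k) /=; last by rewrite all_predC; exact/andP.
    by rewrite lerDl; apply: sumr_ge0.
  case: nE; apply: QE => k kC; apply/negPn/negP => nQ.
  by have := none k; rewrite /= kC nQ.
rewrite mulr_natl -sumr_const; apply: ler_sum => k kC; rewrite sum_tuple_all.
have h : \sum_(S | predC (Q k) S) draw_weight S = 1 - \sum_(S | Q k S) draw_weight S.
  by rewrite -sum_draw_weight [in RHS](bigID (Q k)) /= [X in _ = X - _]addrC addrK.
apply: lerXn2r; rewrite ?nnegrE.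
- by apply: sumr_ge0 => S _; exact: draw_weight_ge0.
- rewrite subr_ge0; apply: le_trans (pQ k kC) _.
  by rewrite -subr_ge0 -h; apply: sumr_ge0 => S _; exact: draw_weight_ge0.
- by rewrite h lerD2l lerN2 pQ.
Qed.

End Draws.

(** * Elementary estimates *)

Lemma bernoulli_ineq (R : realFieldType) (a : R) k : 0 <= a -> 1 + k%:R * a <= (1 + a) ^+ k.
Proof.
move=> a_ge0; elim: k => [|k IH]; first by rewrite mul0r addr0.
have k_ge0 : 0 <= k%:R :> R by [].
rewrite exprS -natr1; move: IH; move: (_ ^+ k) => X IH; nra.
Qed.

(** The sequence [(1 - 1/x)^x] starts at 1/4 for [x = 2] and increases. *)
Lemma quarter_le_pow (R : realType) (m : nat) :
  (4%:R)^-1 <= (1 - m.+2%:R^-1) ^+ m.+2 :> R.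
Proof.
elim: m => [|m IH]; first by lra.
apply: le_trans IH _.
set x : R := m.+2%:R.
have x_ge2 : 2 <= x by rewrite ler_nat.
have -> : m.+3%:R = x + 1 :> R by rewrite natr1.
(* This [c] makes [(1 - 1/x) * (1 + c)] the next base; Bernoulli's inequality bounds the power of
   [1 + c]. *)
pose c := (x ^+ 2 - 1)^-1.
have x2 : 0 < x ^+ 2 - 1 by nra.
have c0 : 0 <= c by rewrite invr_ge0 ltW.
have x_inv : 0 <= 1 - x^-1 by rewrite subr_ge0 invf_le1; lra.
have -> : 1 - (x + 1)^-1 = (1 - x^-1) * (1 + c).
  rewrite /c; field; rewrite !gt_eqF; lra.
rewrite [X in _ <= X]exprS exprMn [X in _ <= X]mulrCA ler_peMr ?exprn_ge0 //.
apply: (@le_trans _ _ ((1 - x^-1) * (1 + c) * (1 + x * c))); last first.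
  apply: ler_wpM2l; last exact: bernoulli_ineq.
  by rewrite mulr_ge0 // addr_ge0.
have -> : (1 - x^-1) * (1 + c) * (1 + x * c) = 1 + ((x + 1) * (x ^+ 2 - 1))^-1.
  by rewrite /c; field; rewrite !gt_eqF; lra.
by rewrite lerDl invr_ge0 mulr_ge0 // ?ltW //; lra.
Qed.

(** * Success probabilities *)

(** For [dmax = 1] the base [1 - 1/dmax] is 0, so [b] must be 0; for larger [dmax] the worst
    exponents are [b = dmax] and [c = 1]. *)
Lemma cylinder_weight_ge (R : realType) (dmax b c : nat) :
  (0 < dmax)%N -> (b <= dmax)%N -> (1 < dmax)%N || (b == 0)%N -> (c <= 1)%N ->
  (4 * dmax%:R)^-1 <= (1 - dmax%:R^-1) ^+ b * dmax%:R^-1 ^+ c :> R.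
Proof.
move=> dmax_gt0 b_le b0 c_le1.
have d0 : 0 < dmax%:R :> R by rewrite ltr0n.
have d1 : dmax%:R^-1 <= 1 :> R by rewrite invf_le1 ?ler1n.
have pow_b : 4^-1 <= (1 - dmax%:R^-1) ^+ b :> R.
  case/orP: b0 => [|/eqP ->]; last by rewrite expr0; lra.
  case: dmax dmax_gt0 b_le d0 d1 => [|[|m]] // _ b_le _ d1 _.
  apply: le_trans (quarter_le_pow R m) _.
  by apply: ler_wiXn2l => //; rewrite subr_ge0.
have pow_c : dmax%:R^-1 <= dmax%:R^-1 ^+ c :> R.
  by case: c c_le1 => [|[|]] //; rewrite expr0.
by rewrite invfM ler_pM // ?invr_ge0 // ltW.
Qed.

(** The sixth power of [exp(1/8) >= 9/8] already exceeds 2. *)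
Lemma ln2_le (R : realType) : ln 2 <= 3 / 4 :> R.
Proof.
rewrite -[leRHS]expRK ler_ln ?posrE ?expR_gt0 //.
have -> : 3 / 4 = 6%:R * 8^-1 :> R by field.
rewrite expRM_natl; apply: (@le_trans _ _ ((1 + 8^-1) ^+ 6)); first by lra.
by apply: lerXn2r; rewrite ?nnegrE ?expR_ge0 ?expR_ge1Dx //; lra.
Qed.

Lemma log2_mul_ln2 (R : realType) (x : R) : log2 x * ln 2 = ln x.
Proof. by rewrite /log2 divfK // gt_eqF // ln_gt0 ?ltr1n. Qed.

Lemma le_log2 (R : realType) (n p q : nat) : (0 < n)%N -> (0 < q)%N -> (2 ^ p <= n ^ q)%N ->
  p%:R / q%:R <= log2 (n%:R : R).
Proof.
move=> n_gt0 q_gt0 pq; have ln2 : 0 < ln 2 :> R by rewrite ln_gt0 ?ltr1n.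
rewrite ler_pdivrMr ?ltr0n // -(ler_pM2r ln2) mulrAC log2_mul_ln2 !mulr_natr.
rewrite mulr_natl -!lnXn ?ltr0n //.
by rewrite ler_ln ?posrE ?exprn_gt0 ?ltr0n // -!natrX ler_nat.
Qed.

Lemma miss_probability_le (R : realType) (dmax n : nat) : (0 < dmax)%N -> (1 < n)%N ->
  (1 - (4 * dmax%:R)^-1) ^+ iterations (log2 (n%:R : R)) dmax n
  <= (n%:R `^ log2 n%:R)^-1 :> R.
Proof.
move=> dmax_gt0 n_gt1; set L : R := log2 _; set T := iterations L dmax n.
have n_gt0 : (0 < n)%N := ltnW n_gt1.
have d1 : 1 <= dmax%:R :> R by rewrite ler1n.
have L1 : 1 <= L.
  by have := @le_log2 R n 1 1 n_gt0 isT; rewrite divr1 !expn1; apply.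
set p := (4 * dmax%:R)^-1 : R.
have p_le : p <= 4^-1 by rewrite /p lef_pV2 ?posrE; lra.
have p_gt0 : 0 < p by rewrite /p invr_gt0; lra.
apply: (@le_trans _ _ (expR (- p) ^+ T)).
  apply: lerXn2r; rewrite ?nnegrE ?expR_ge0 //; last exact: expR_ge1Dx.
  by lra.
rewrite -expRM_natl -powRN /powR gt_eqF ?ltr0n // ler_expR -log2_mul_ln2 -/L.
have ln2_ge0 : 0 <= ln 2 :> R by rewrite ln_ge0 ?ler1n.
have ln2_le := ln2_le R.
(* Rounding down loses less than one iteration, hence at most [p] here. *)
have pT : L ^+ 2 - p <= p * T%:R.
  have := truncnS_gt (4 * L * dmax%:R * L); rewrite -/(iterations _ _ _) -/T -[T.+1%:R]natr1.
  move/ltW/(ler_wpM2l (ltW p_gt0)).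
  have -> : p * (4 * L * dmax%:R * L) = L ^+ 2 by rewrite /p; field; rewrite gt_eqF; lra.
  by rewrite mulrDr mulr1 lerBlDr.
(* As [L >= 1], the remaining gap [L ^+ 2 / 4] absorbs [p <= 1/4]. *)
have : L * (L * ln 2) <= L ^+ 2 * (3 / 4) by rewrite mulrA ler_wpM2l // sqr_ge0.
nra.
Qed.

Section Model.
Context (R : realType) (d : measure_display) (Omega : measurableType d)
  (P : probability Omega R) (n : nat) (M : gaussian_anm P n).

Lemma edge_observable_graph u v : edge (observable_graph M) u v = (u \in parents M v).
Proof. by rewrite /edge inE. Qed.

Lemma outcome_sink v : ~~ edge (observable_graph M) None v.
Proof.
case: v => [i|].
  by apply: contra (outcome_no_treatment_descendant M i) => /connect1.
exact/acyclic_irrefl/parents_acyclic.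
Qed.

Lemma parents_treatments v : parents M v = treatments [set i | Some i \in parents M v].
Proof.
apply/setP => -[i|]; first by rewrite mem_treatments inE.
by rewrite (negbTE (None_treatments _)) -edge_observable_graph (negbTE (outcome_sink v)).
Qed.

Lemma card_parents v : (#|parents M v| <= max_degree (observable_graph M))%N.
Proof.
apply: leq_trans (leq_bigmax v); apply/subset_leq_card/fintype.subsetP => u uv.
by rewrite inE !edge_observable_graph uv orbT.
Qed.

(** Edges between treatments are coded by their index pairs; the diagonal, free of edges by
    acyclicity, codes the edges into the outcome. *)
Lemma card_observable_graph : (#|observable_graph M| <= n * n)%N.
Proof.
pose f (x : 'I_n * 'I_n) : vertex n * vertex n :=
  (Some x.1, if x.1 == x.2 then None else Some x.2).
have -> : (n * n)%N = #|[set: 'I_n * 'I_n]| by rewrite cardsT card_prod card_ord.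
apply: leq_trans (leq_imset_card f _); apply/subset_leq_card/fintype.subsetP.
move=> [[i|] v]; last by move/negP: (outcome_sink v) => + h; case.
case: v => [j|] ij; apply/imsetP; last by exists (i, i); rewrite // /f eqxx.
exists (i, j); rewrite // /f /=; case: eqVneq => // ijE; move: ij; rewrite ijE => jj.
by have /negP [] := acyclic_irrefl (Some j) (parents_acyclic M).
Qed.

Lemma card_treatments (S : {set 'I_n}) : #|treatments S| = #|S|.
Proof. by rewrite finset.card_imset // => ? ? []. Qed.

Lemma treatments_sub (S T : {set 'I_n}) : (treatments S \subset treatments T) = (S \subset T).
Proof.
apply/fintype.subsetP/fintype.subsetP => ST x; last first.
  by case/imsetP => i /ST iT ->; rewrite mem_treatments.
by move=> xS; have := ST (Some x); rewrite !mem_treatments; apply.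
Qed.

(** Union bound with one event per treatment. With [dmax = 1] every draw would almost surely be
    empty and contain no parent. *)
Lemma required_data_probability dmax T :
  (1 < dmax)%N -> (max_degree (observable_graph M) <= dmax)%N ->
  1 - n%:R * (1 - (4 * dmax%:R)^-1) ^+ T <=
  draws_prob R dmax (fun Ss : T.-tuple {set 'I_n} => has_required_data M Ss).
Proof.
move=> dmax_gt1 dmax_ge.
have -> : n%:R = #|'I_n|%:R :> R by rewrite card_ord.
apply: (@draws_prob_union R dmax n _ T _ _
          (fun i S => (parents M (Some i) \subset treatments S) && (i \notin S)))
  => [|i _|Ss req].
- exact: ltnW.
- set B := [set j | Some j \in parents M (Some i)].
  have iB : i \notin B.
    by rewrite inE -edge_observable_graph; exact/acyclic_irrefl/parents_acyclic.
  have Bd : (#|B| <= dmax)%N.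
    by rewrite -card_treatments -parents_treatments (leq_trans (card_parents _)).
  have := @sum_draw_weight_cylinder R dmax n B [set i].
  rewrite fintype.disjoint_sym disjoints1 => /(_ iB) sumE.
  apply: le_trans (cylinder_weight_ge R _ Bd _ (leqnn 1)) _; [exact: ltnW|by rewrite dmax_gt1|].
  rewrite -(cards1 i) -sumE le_eqVlt; apply/orP; left; apply/eqP/eq_bigl => S.
  by rewrite parents_treatments treatments_sub disjoints1.
- by apply/forallP => i; apply: req.
Qed.

(** Union bound with one event per edge [u -> v]. Only the parents other than [u] must be drawn, so
    for [dmax = 1] there are none to draw. *)
Lemma learning_probability dmax T (dep : {set 'I_n} -> rel (vertex n)) sys :
  (1 < n)%N -> (0 < dmax)%N -> (max_degree (observable_graph M) <= dmax)%N ->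
  correct_tests M dep -> strongly_separating sys ->
  1 - (n * n)%:R * (1 - (4 * dmax%:R)^-1) ^+ T <=
  draws_prob R dmax (fun Ss : T.-tuple {set 'I_n} =>
    learn_observable_graph dep sys Ss == observable_graph M).
Proof.
move=> n_gt1 dmax_gt0 dmax_ge dep_correct sysP.
have d1 : 1 <= dmax%:R :> R by rewrite ler1n.
have p_le1 : (4 * dmax%:R)^-1 <= 1 :> R by rewrite invf_le1; lra.
pose found (e : vertex n * vertex n) (S : {set 'I_n}) := (e.2 \notin treatments S) &&
  [forall w, (edge (observable_graph M) w e.2 && (w != e.1)) ==> (w \in treatments S)].
apply: (@le_trans _ _ (1 - #|observable_graph M|%:R * (1 - (4 * dmax%:R)^-1) ^+ T)).
  rewrite lerD2l lerN2 ler_wpM2r ?exprn_ge0 ?subr_ge0 //.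
  by rewrite ler_nat card_observable_graph.
apply: (@draws_prob_union R dmax n _ T _ _ found) => [//|[u v] uv|Ss req]; last first.
  apply/eqP; apply: (learn_observable_graph_complete (G := latent_graph M)) => //.
  - exact: parents_acyclic.
  - exact: outcome_sink.
  - by move=> u v uv; apply: (req (u, v)).
set B := [set j | Some j \in parents M v :\ u].
(* [C] is empty when [v] is the outcome, which no draw contains. *)
set C : {set 'I_n} := [set j | Some j == v].
have uv' : u \in parents M v by rewrite -edge_observable_graph.
have TB : treatments B = parents M v :\ u.
  apply/setP => -[j|]; first by rewrite mem_treatments inE.
  rewrite finset.in_setD1 parents_treatments.
  by rewrite !(negbTE (None_treatments _)) andbF.
have Bd : (#|B| < dmax)%N.
  rewrite -card_treatments TB; apply: leq_trans dmax_ge; apply: leq_trans (card_parents v).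
  by rewrite [leqRHS](cardsD1 u) uv'.
have C1 : (#|C| <= 1)%N.
  apply/card_le1_eqP => i j; by rewrite !inE => /eqP <- /eqP[].
have BC : [disjoint B & C].
  apply/pred0P => j; rewrite !inE; apply/negP => /andP[/andP[_ jv] /eqP jvE].
  have /negP := acyclic_irrefl v (parents_acyclic M); apply.
  by rewrite [edge _ _ _]edge_observable_graph -{1}jvE.
apply: le_trans (cylinder_weight_ge R dmax_gt0 (ltnW Bd) _ C1) _.
  by case: (dmax) Bd => [|[|]] //; rewrite ltnS leqn0 => ->; rewrite orbT.
rewrite -sum_draw_weight_cylinder // le_eqVlt; apply/orP; left; apply/eqP/eq_bigl => S.
rewrite andbC /found -treatments_sub TB /=; congr (_ && _).
  rewrite disjoint_subset; apply/fintype.subsetP/idP => [CS|vS i].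
    case: v {uv TB BC uv' Bd B} @C CS C1 => [i|] C CS _; last exact: None_treatments.
    by rewrite mem_treatments; apply: CS; rewrite inE.
  by rewrite !inE => /eqP iv; move: vS; rewrite -iv mem_treatments.
apply/fintype.subsetP/forallP => [PS w|PS w].
  rewrite edge_observable_graph; apply/implyP => /andP[wv wu].
  by apply: PS; rewrite finset.in_setD1 wu.
rewrite finset.in_setD1 => /andP[wu wv].
by move: (PS w); rewrite edge_observable_graph wv wu.
Qed.

End Model.

(** * Separating systems and the number of interventions *)

(** Each member collects the treatments whose label contains a given point. Distinct labels of equal
    size are incomparable, which separates both ways; the labels in a complement are [k]-subsets
    avoiding that point. *)
Lemma exists_separating_system (n m k : nat) : (n <= 'C(m, k))%N ->
  exists sys : {set {set 'I_n}}, [/\ strongly_separating sys, (#|sys| <= m)%N &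
    forall A, A \in sys -> (#|~: A| <= 'C(m.-1, k))%N].
Proof.
move=> n_le; pose D := [set B : {set 'I_m} | #|B| == k].
have nD : (n <= #|D|)%N by rewrite card_draws card_ord.
pose c i := enum_val (widen_ord nD i).
have c_inj : injective c by move=> i j /enum_val_inj /(congr1 val) /= /val_inj.
have card_c i : #|c i| = k by have := enum_valP (widen_ord nD i); rewrite inE => /eqP.
pose A r := [set i | r \in c i].
have sep i j : i != j -> exists2 r, r \in c i & r \notin c j.
  move=> ij; apply/subsetPn; apply: contra ij => cij; apply/eqP/c_inj/eqP.
  by rewrite eqEcard cij !card_c leqnn.
exists [set A r | r : 'I_m]; split.
- move=> i j ij; have [r ri rj] := sep i j ij.
  have [s sj si] := sep j i ltac:(by rewrite eq_sym).
  by exists (A r), (A s); rewrite !imset_f // !inE ri rj si sj.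
- by apply: leq_trans (leq_imset_card _ _) _; rewrite card_ord.
- move=> _ /imsetP [r _ ->].
  have -> : m.-1 = #|[set~ r]| by rewrite finset.cardsC1 card_ord.
  rewrite -cards_draws -(finset.card_imset _ c_inj).
  apply/subset_leq_card/fintype.subsetP => _ /imsetP [i + ->]; rewrite !inE => ri.
  by rewrite card_c eqxx andbT finset.subsetC finset.sub1set inE.
Qed.

Lemma card_interventions_mul n (sys : {set {set 'I_n}}) Ss :
  (#|interventions sys Ss| <= size Ss * #|sys|.+1)%N.
Proof.
rewrite /interventions; elim: Ss => [|S Ss IH]; first by rewrite big_nil cards0.
rewrite big_cons /= mulSn; apply: leq_trans (leq_card_setU _ _) (leq_add _ IH).
apply: leq_trans (leq_card_setU _ _) _.
by rewrite cards1 add1n ltnS leq_imset_card.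
Qed.

Lemma card_interventions_pow n (sys : {set {set 'I_n}}) Ss :
  (#|interventions sys Ss| <= 2 ^ n)%N.
Proof.
apply: leq_trans (max_card _) _.
by rewrite -finset.cardsT -powersetT card_powerset cardsT card_ord.
Qed.

(* Every target is a drawn set or contains a member of the separating system, so
   large members limit the number of targets. *)
Lemma card_interventions_add n (sys : {set {set 'I_n}}) Ss b :
  (forall A, A \in sys -> #|~: A| <= b)%N ->
  (#|interventions sys Ss| <= size Ss + #|sys| * 2 ^ b)%N.
Proof.
move=> sysb.
pose supersets (A : {set 'I_n}) := [set X : {set 'I_n} | A \subset X].
have sub : interventions sys Ss \subset [set S in Ss] :|: \bigcup_(A in sys) supersets A.
  apply/fintype.subsetP => X; rewrite /interventions.
  elim: Ss => [|S Ss IH]; first by rewrite big_nil inE.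
  rewrite big_cons finset.in_setU => /orP[/setU1P[->|/imsetP [A As ->]]|/IH].
  - by rewrite !inE eqxx.
  - apply/setUP; right; apply/bigcupP; exists A => //.
    by rewrite inE finset.subsetUr.
  - by rewrite !finset.in_setU !inE => /orP[->|->]; rewrite ?orbT.
apply: leq_trans (subset_leq_card sub) _; apply: leq_trans (leq_card_setU _ _) _.
apply: leq_add; first by rewrite cardsE card_size.
rewrite -sum_nat_const.
apply: (big_rec2 (fun (X : {set {set 'I_n}}) m => #|X| <= m)%N); first by rewrite cards0.
move=> A X m As Xm; apply: leq_trans (leq_card_setU _ _) (leq_add _ Xm).
apply: (@leq_trans (2 ^ #|~: A|)); last by rewrite leq_pexp2l ?sysb.
(* Complementation turns supersets of [A] into subsets of [~: A]. *)
rewrite -card_powerset -(finset.card_imset _ (can_inj (@finset.setCK _))).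
apply/subset_leq_card/fintype.subsetP => Y; rewrite inE => AY.
by apply/imsetP; exists (~: Y); rewrite ?finset.setCK // powersetE finset.setCS.
Qed.

(** * Growth of central binomial coefficients *)

Lemma exp2_le_central_binomial k : (2 ^ k <= 'C(2 * k, k))%N.
Proof.
elim: k => // k IH; rewrite mul2n doubleS -mul2n binS binS.
have : ('C(2 * k, k) <= 'C((2 * k).+1, k))%N by case: (k) => [|j] //; rewrite [leqRHS]binS leq_addr.
by rewrite expnS; lia.
Qed.

(** Squares avoid half-integer exponents. From row [2k] to row [2k + 1] the coefficient grows by a
    factor of at least 3/2, and from there to row [2k + 2] by exactly 2; both factors have squares
    at least 2. The base values are 20 and 35. *)
Lemma central_binomial_sqr_ge k : (3 <= k)%N ->
  (2 ^ (2 * k + 2) <= 'C(2 * k, k) ^ 2)%N && (2 ^ (2 * k + 3) <= 'C((2 * k).+1, k) ^ 2)%N.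
Proof.
have odd_even j : ('C(2 * j.+1, j.+1) = 2 * 'C((2 * j).+1, j))%N.
  rewrite mul2n doubleS -mul2n binS -[in 'C(_, j.+1)]bin_sub; last by lia.
  have -> : ((2 * j).+1 - j.+1 = j)%N by lia.
  lia.
have even_odd j : (0 < j)%N -> (3 * 'C(2 * j, j) <= 2 * 'C((2 * j).+1, j))%N.
  move=> j0; have := mul_bin_diag (2 * j).+1 j; rewrite /=.
  rewrite -[in 'C(_, j.+1)]bin_sub; last by lia.
  have -> : ((2 * j).+1 - j.+1 = j)%N by lia.
  nia.
have step j : (0 < j)%N -> (2 ^ (2 * j + 2) <= 'C(2 * j, j) ^ 2)%N ->
    (2 ^ (2 * j + 3) <= 'C((2 * j).+1, j) ^ 2)%N.
  have -> : (2 * j + 3 = (2 * j + 2).+1)%N by lia.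
  move=> /even_odd ab; have := leq_mul ab ab; rewrite (expnS 2) -!mulnn.
  by move: (2 ^ _)%N 'C(_, _) 'C(_, _) {ab} => t a b; lia.
elim: k => // k IH; rewrite leq_eqVlt => /orP[/eqP <-|k3] //.
have {IH} /andP[_ IH] := IH k3.
have e : (2 ^ (2 * k.+1 + 2) <= 'C(2 * k.+1, k.+1) ^ 2)%N.
  have -> : (2 * k.+1 + 2 = (2 * k + 3).+1)%N by lia.
  rewrite odd_even; move: IH; rewrite (expnS 2 (2 * k + 3)) -!mulnn.
  by move: (2 ^ _)%N 'C(_, _) => t a; lia.
by rewrite e step.
Qed.

(** For [n > 11], [m + 1] is the rounded-down logarithm of [n ^ 2], so [n ^ 2 < 2 ^ (m + 2)], which
    is at most the square of the middle binomial. For [n = 11] this forces [m <= 5], whose largest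
    binomial is 10. *)
Lemma exists_binomial_ge n : (7 < n)%N -> n != 11%N ->
  exists m k, (n <= 'C(m, k))%N /\ (2 ^ m.+1 <= n ^ 2)%N.
Proof.
move=> n_gt7 n11; have [n_gt11|n_le11] := ltnP 11 n; last first.
  exists 5, 2; move: n_le11 n11 n_gt7.
  by do 12 (case: n => [|n] //).
have n2 : (2 ^ 7 <= n ^ 2)%N by rewrite -mulnn; nia.
have /andP[lo hi] := @trunc_log_bounds 2 (n ^ 2) isT ltac:(lia).
have l_ge7 : (7 <= trunc_log 2 (n ^ 2))%N by rewrite trunc_log_max.
move: (trunc_log _ _) l_ge7 lo hi => l l7 lo hi.
have [k [k3 lE]] : exists k, (3 <= k /\ (l = 2 * k + 1 \/ l = 2 * k + 2))%N.
  by exists (l.-1)./2; lia.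
have /andP[even_k odd_k] := central_binomial_sqr_ge k3.
exists l.-1, k; rewrite prednK; last by lia.
split=> //; rewrite -(leq_exp2r _ _ (isT : 0 < 2)%N) (leq_trans (ltnW hi)) //.
case: lE => ->.
  by rewrite addn1 /=; move: even_k; rewrite (_ : (2 * k + 2 = (2 * k).+2)%N) // addn2.
by rewrite addn2 /=; move: odd_k; rewrite addn3.
Qed.

Lemma exists_system_few_interventions (R : realType) (dmax n : nat) :
  (0 < n)%N -> (0 < dmax)%N -> let L : R := log2 n%:R in
  exists2 sys : {set {set 'I_n}}, admissible_system sys &
    forall Ss : (iterations L dmax n).-tuple {set 'I_n},
      #|interventions sys Ss|%:R <= 8 * dmax%:R * L ^+ 3.
Proof.
move=> n_gt0 dmax_gt0 L.
have d1 : 1 <= dmax%:R :> R by rewrite ler1n.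
have L_ge p q : (0 < q)%N -> (2 ^ p <= n ^ q)%N -> p%:R / q%:R <= L by apply: le_log2.
have L_1 : n = 1%N -> L = 0 by move=> n1; rewrite /L /log2 n1 ln1 mul0r.
have iterE : iterations L dmax n = Num.truncn (4 * L * dmax%:R * L) by [].
move: (iterations L dmax n) iterE => T TE; clearbody L.
have L0 : 0 <= L by have := @L_ge 0 1 isT; rewrite mul0r; apply; rewrite expn1.
have T_le : T%:R <= 4 * dmax%:R * L ^+ 2.
  apply: (@le_trans _ _ (4 * L * dmax%:R * L)); last first.
    by rewrite le_eqVlt; apply/orP; left; apply/eqP; ring.
  by rewrite TE truncn_le !mulr_ge0.
have n_up : (n <= 2 ^ up_log 2 n)%N by rewrite up_logP.
have [n1|n_neq1] := eqVneq n 1%N.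
  (* Here [L = 0]: there are no iterations, and the bound itself is 0. *)
  have [sys [sep sys_le _]] := @exists_separating_system n 0 0 ltac:(by rewrite n1).
  exists sys; first by split=> //; apply: leq_trans sys_le _.
  have T0 : T = 0%N.
    by rewrite TE L_1 // mulr0 truncn0.
  rewrite {}T0 in TE T_le * => Ss; rewrite tuple0 /interventions big_nil cards0.
  by rewrite !mulr_ge0 ?exprn_ge0 ?ler0n.
have L_ge1 : 1 <= L by have := @L_ge 1 1 isT; rewrite divr1; apply; rewrite !expn1; lia.
have [n_le7|n_gt7] := leqP n 7.
  have [sys [sep sys_le _]] := exists_separating_system
    (leq_trans n_up (exp2_le_central_binomial _)).
  exists sys => // Ss.
  apply: (@le_trans _ _ (2 ^ n)%:R); first by rewrite ler_nat card_interventions_pow.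
  have [n_le3|n_gt3] := leqP n 3.
    apply: (@le_trans _ _ 8); first by rewrite ler_nat (leq_pexp2l _ n_le3).
    have : 1 <= L ^+ 3 by rewrite exprn_ege1.
    nra.
  have L_ge2 : 2 <= L.
    by have := @L_ge 2 1 isT; rewrite divr1; apply; rewrite !expn1.
  have [n_le6|n_gt6] := leqP n 6.
    apply: (@le_trans _ _ 64); first by rewrite ler_nat (leq_pexp2l _ n_le6).
    have : 8 <= L ^+ 3 by have := lerXn2r 3 _ _ L_ge2; rewrite !nnegrE; lra.
    nra.
  have n7 : n = 7 by lia.
  rewrite n7.
  (* From [2 ^ 11 <= 7 ^ 4]; the cube exceeds 16, and [8 * 16 = 2 ^ 7]. *)
  have {}L_ge : 11 / 4 <= L by apply: L_ge; rewrite // n7.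
  have : 16 <= L ^+ 3 by have := lerXn2r 3 _ _ L_ge; rewrite !nnegrE; lra.
  rewrite (_ : (2 ^ 7)%:R = 128 :> R) //; nra.
have [n11|n_neq11] := eqVneq n 11%N.
  (* Complements of members have at most ['C(5, 4) = 5] elements, so besides the drawn sets there
     are at most [6 * 2 ^ 5 = 192] targets. *)
  have [sys [sep sys_le sys_large]] := @exists_separating_system n 6 4 ltac:(by rewrite n11).
  exists sys; first by split=> //; apply: leq_trans sys_le _; rewrite n11.
  move=> Ss; apply: (@le_trans _ _ (T + 6 * 2 ^ 5)%:R).
    rewrite ler_nat; apply: leq_trans (card_interventions_add _ sys_large) _.
    by rewrite size_tuple leq_add2l leq_mul2r sys_le.
  (* From [2 ^ 13 <= 11 ^ 4]; then [(8 * L - 4) * L ^+ 2] is at least 220, above the 192 needed. *)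
  have {}L_ge : 13 / 4 <= L by apply: L_ge; rewrite // n11.
  rewrite natrD (_ : (6 * 2 ^ 5)%:R = 192 :> R) //.
  have L2 : 10 <= L ^+ 2 by nra.
  have : 10 * 22 * dmax%:R <= (8 * L - 4) * L ^+ 2 * dmax%:R by rewrite ler_wpM2r; nra.
  have -> : 8 * dmax%:R * L ^+ 3 = (8 * L - 4) * L ^+ 2 * dmax%:R + 4 * dmax%:R * L ^+ 2 by ring.
  lra.
have [m [k [n_bin n_sqr]]] := exists_binomial_ge n_gt7 n_neq11.
have [sys [sep sys_le _]] := exists_separating_system n_bin.
(* The inequality [2 ^ m.+1 <= n ^ 2] serves twice: for admissibility, and for [m.+1 <= 2 * L],
   where the extra one counts the drawn set. *)
have m_up : (m.+1 <= 2 * up_log 2 n)%N.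
  rewrite -(leq_exp2l _ _ (isT : 1 < 2)%N) (leq_trans n_sqr) //.
  by rewrite mulnC expnM leq_exp2r.
exists sys; first by split=> //; lia.
move=> Ss; apply: (@le_trans _ _ (T * m.+1)%:R).
  rewrite ler_nat; apply: leq_trans (card_interventions_mul _ _) _.
  by rewrite size_tuple leq_mul2l ltnS sys_le orbT.
have m_L : m.+1%:R <= 2 * L.
  by have := L_ge _ 2 isT n_sqr; rewrite ler_pdivrMr // mulrC.
rewrite natrM (_ : 8 * dmax%:R * L ^+ 3 = 4 * dmax%:R * L ^+ 2 * (2 * L)); last by ring.
by rewrite ler_pM ?ler0n.
Qed.

Theorem corollary2 (R : realType) (d : measure_display) (Omega : measurableType d)
    (P : probability Omega R) (n : nat) (n_gt0 : (0 < n)%N)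
    (M : gaussian_anm P n) (dmax : nat) (dmax_gt0 : (0 < dmax)%N)
    (dmax_ge : (max_degree (observable_graph M) <= dmax)%N)
    (dep : {set 'I_n} -> rel (vertex n)) (dep_correct : correct_tests M dep) :
  let L : R := log2 n%:R in
  let T := iterations L dmax n in
  [/\ exists2 sys : {set {set 'I_n}}, admissible_system sys &
        forall Ss : T.-tuple {set 'I_n},
          #|interventions sys Ss|%:R <= 8 * dmax%:R * L ^+ 3,
      forall sys : {set {set 'I_n}}, admissible_system sys ->
        1 - (n%:R `^ (L - 2))^-1 <=
        draws_prob R dmax
          (fun Ss : T.-tuple {set 'I_n} =>
             learn_observable_graph dep sys Ss == observable_graph M) &
      (1 < dmax)%N ->
        1 - (n%:R `^ (L - 1))^-1 <=
        draws_prob R dmax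
          (fun Ss : T.-tuple {set 'I_n} => has_required_data M Ss)].
Proof.
move=> L T.
have n0 : n%:R != 0 :> R by rewrite pnatr_eq0 -lt0n.
(* The factor [n^r] bounds the number of events in the union bound: edges for [r = 2], treatments
   for [r = 1]. *)
have bound r : 1 - (n%:R `^ (L - r))^-1 = 1 - n%:R `^ r * (n%:R `^ L)^-1.
  by rewrite powRB ?n0 ?implybT // invf_div.
(* For [n = 1] all powers of [n] are 1, so both claimed lower bounds are 0. *)
have [n_le1|n_gt1] := leqP n 1.
  have n1 : n = 1%N by lia.
  split=> [|sys _|_]; first exact: exists_system_few_interventions.
    by rewrite {1}n1 powR1 invr1 subrr; exact: draws_prob_ge0.
  by rewrite {1}n1 powR1 invr1 subrr; exact: draws_prob_ge0.
have miss := miss_probability_le R dmax_gt0 n_gt1.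
split=> [|sys [sysP _]|dmax_gt1]; first exact: exists_system_few_interventions.
  apply: le_trans (learning_probability _ n_gt1 dmax_gt0 dmax_ge dep_correct sysP).
  by rewrite bound lerD2l lerN2 powR_mulrn ?ler0n // expr2 [(n * n)%:R]natrM ler_wpM2l ?mulr_ge0.
apply: le_trans (required_data_probability _ dmax_gt1 dmax_ge).
by rewrite bound lerD2l lerN2 powRr1 ?ler0n // ler_wpM2l ?ler0n.
Qed.
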